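(* Let $p$ be a prime and $\alpha,l,n\in\mathbb{N}$. For $r\in\mathbb{Z}$ let $$T_l(n,r)=\frac{l!\,p^l}{\lfloor n/p^{\alpha-1}\rfloor!}\sum_{k\equiv r\ (\mathrm{mod}\ p^{\alpha})}\binom nk(-1)^k\binom{(k-r)/p^{\alpha}}l.$$ Then for all $r\in\mathbb{Z}$, $$\operatorname{ord}_p(T_l(n,r))\geqslant\tau_p\big(\{r\}_{p^{\alpha-1}},\{n-r\}_{p^{\alpha-1}}\big).$$
   Context: When $\alpha=0$, $\lfloor n/p^{-1}\rfloor=pn$. The sum runs over all integers $k\equiv r\pmod{p^\alpha}$, with $\binom nk=0$ unless $0\le k\le n$; $\binom xl=x(x-1)\cdots(x-l+1)/l!$. $\operatorname{ord}_p$ is the $p$-adic order. For an integer $a$ and positive real $m$, $\{a\}_m$ is the unique number in $[0,m)$ with $a-\{a\}_m\in m\mathbb{Z}$. $\tau_p(a,b)$ is the number of carries when adding $a,b\in\mathbb{N}$ in base $p$. *)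

(* Defs.v *)
From mathcomp Require Import all_boot all_order all_algebra.
Set Implicit Arguments. Unset Strict Implicit. Unset Printing Implicit Defensive.
Import Order.TTheory GRing.Theory Num.Theory.
Local Open Scope ring_scope.

Definition gbinom (x : rat) (l : nat) : rat :=
  (\prod_(i < l) (x - i%:R)) / (l`!)%:R.

Definition ordp (p : nat) (q : rat) : int :=
  (logn p `|numq q|%N)%:Z - (logn p `|denq q|%N)%:Z.

Fixpoint carries (p fuel a b : nat) (c : bool) : nat :=
  match fuel with
  | 0 => 0
  | f.+1 =>
      let c' := (p <= a %% p + b %% p + c)%N in
      (c' + carries p f (a %/ p) (b %/ p) c')%N
  end.

(* tau_p(a,b): number of carries when adding a and b in base p.
   a + b + 1 digit positions are more than enough (for p >= 2). *)
Definition tau (p a b : nat) : nat := carries p (a + b).+1 a b false.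

(* floor(n / p^(alpha-1)), with the convention floor(n/p^(-1)) = p n. *)
Definition floor_pm1 (p alpha n : nat) : nat :=
  if alpha is a.+1 then (n %/ p ^ a)%N else (p * n)%N.

(* {x}_{p^(alpha-1)} for an integer x: the unique element of [0, p^(alpha-1))
   congruent to x modulo p^(alpha-1) Z; for alpha = 0 the modulus is 1/p and
   x - 0 lies in (1/p)Z, so the value is 0. Returned as a nat. *)
Definition frac_pm1 (p alpha : nat) (x : int) : nat :=
  if alpha is a.+1 then `|(x %% (p ^ a)%:Z)%Z|%N else 0%N.

Definition T (p alpha l n : nat) (r : int) : rat :=
  (l`!)%:R * (p ^ l)%:R / ((floor_pm1 p alpha n)`!)%:R *
  \sum_(0 <= k < n.+1 | (k%:Z == r %[mod (p ^ alpha)%:Z])%Z)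
     ('C(n, k))%:R * (-1) ^+ k * gbinom (((k%:Z - r) %/ (p ^ alpha)%:Z)%Z)%:~R l.

(* Main.v *)
Require Import Defs.
From mathcomp Require Import all_boot all_order all_algebra.
From mathcomp Require Import ring zify.
Import Order.TTheory GRing.Theory Num.Theory.
Local Open Scope ring_scope.

(* Put Q = p^alpha and let D_{l,r} be the linear functional on rational
   polynomials sending X^k to prod_{i<l} p((k-r)/Q - i) if k = r mod Q, and to 0
   otherwise, so that T_l(n,r) = D_{l,r}((1-X)^n) / floor(n/p^(alpha-1))!.

   Integrality.  Pascal's rule gives D_{l,r}(w f) = l D_{l-1,r}(f) for
   w = (X^Q - 1)/p, so multiplication by w^m/m! preserves the module of
   polynomials on which every D_{l,r} is p-integral; the multipliers of this
   module form a ring.  With q = p^(alpha-1) and u = X^q - 1, the Frobenius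
   congruence reads u^p = p (w - u c) with c integral, whence u^n/n! is a
   multiplier by strong induction on n; then so are the divided powers of
   (X-1)^q = u + p g, and T_l(n,r) is p-integral.

   Carries.  Applying D_{l,r} to X d/dX (1-X)^n gives
     (r + Q l) T_l(n,r) = - q T_{l+1}(n,r) - N T_l(n-1,r-1),
   with N = q if q | n and N = n otherwise.  If v = ord_p(r) < alpha-1 then
   r + Q l has order v, v + tau_p <= alpha-1, and Kummer's theorem gives
   v + tau_p({r},{n-r}) = ord_p({r}+{n-r}) + tau_p({r-1},{n-r}), where
   ord_p({r}+{n-r}) <= ord_p(N); so the bound follows by induction on n. *)

(** * Legendre's formula and Kummer's carry count *)

Lemma legendre_step (p n : nat) : prime p ->
  logn p n`! = (n %/ p + logn p (n %/ p)`!)%N.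
Proof.
move=> p_pr; rewrite !logn_fact //.
have p_gt1 := prime_gt1 p_pr.
(* Terms with [k > m] vanish because [m < p ^ m], so both Legendre sums can be padded to a common
   range. *)
have trunc m N : (m <= N)%N ->
  (\sum_(1 <= k < m.+1) m %/ p ^ k = \sum_(1 <= k < N.+1) m %/ p ^ k)%N.
  move=> mN; rewrite [RHS](big_cat_nat _ (n := m.+1)) //=.
  rewrite [X in (_ + X)%N]big1_seq ?addn0 // => k /=.
  rewrite mem_index_iota => /andP[mk _]; apply: divn_small.
  by apply: (leq_trans mk); apply/ltnW/ltn_expl.
rewrite (trunc (n %/ p)%N n) ?leq_div // (trunc n n.+1) //.
rewrite big_nat_recl // expn1; congr addn.
by rewrite !big_add1 /=; apply: eq_bigr => k _; rewrite expnS divnMA.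
Qed.

(* Kummer's theorem in additive form, with an incoming carry. *)
Lemma carries_logn (p f a b : nat) (c : bool) : prime p -> (a + b + c <= f)%N ->
  (carries p f a b c + logn p a`! + logn p b`! = logn p (a + b + c)`!)%N.
Proof.
move=> p_pr; have p_gt1 := prime_gt1 p_pr.
elim: f a b c => [|f IHf] a b c /=.
  by rewrite leqn0 !addn_eq0 => /andP[/andP[/eqP-> /eqP->] /eqP->]; rewrite fact0 logn1.
move=> le_f; set c' := (p <= _)%N.
have Ediv : ((a + b + c) %/ p = a %/ p + b %/ p + c')%N.
  rewrite {1}(divn_eq a p) {1}(divn_eq b p).
  have -> : (a %/ p * p + a %% p + (b %/ p * p + b %% p) + c =
     (a %/ p + b %/ p) * p + (a %% p + b %% p + c))%N by rewrite mulnDl; lia.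
  rewrite divnMDl ?(ltnW p_gt1) //; congr addn.
  have ha : (a %% p < p)%N by rewrite ltn_mod ltnW.
  have hb : (b %% p < p)%N by rewrite ltn_mod ltnW.
  rewrite /c'; case: leqP => hc; last by rewrite divn_small.
  by case: c {le_f c'} hc => hc; apply/eqP; rewrite eqn_leq -ltnS ltn_divLR ?leq_divRL; lia.
rewrite (legendre_step p a) // (legendre_step p b) // (legendre_step p (_ + c)) //.
rewrite Ediv -IHf; first lia.
rewrite -Ediv; case: (posnP (a + b + c)) => [->|h]; first by rewrite div0n.
by rewrite -ltnS (leq_trans _ le_f) // ltn_Pdiv.
Qed.

Lemma tau_logn (p a b : nat) : prime p ->
  (tau p a b + logn p a`! + logn p b`! = logn p (a + b)`!)%N.
Proof.
by move=> p_pr; rewrite /tau carries_logn // addn0.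
Qed.

Lemma carries_le_digits (p f a b d : nat) (c : bool) : (1 < p)%N ->
  (a < p ^ d)%N -> (b < p ^ d)%N -> (carries p f a b c <= d)%N.
Proof.
move=> p_gt1; elim: f a b d c => [|f IHf] a b [|d] c //=.
  rewrite expn0 !ltnS !leqn0 => /eqP-> /eqP->; rewrite !mod0n !div0n !add0n.
  (* Both numbers are exhausted: an incoming carry is at most 1, below [p], and dies out. *)
  rewrite (_ : (p <= c)%N = false) ?add0n; last by case: c; lia.
  by rewrite -leqn0 (IHf 0%N 0%N 0%N).
rewrite !expnS => ha hb; rewrite -add1n leq_add ?leq_b1 // IHf //.
  by rewrite ltn_divLR 1?mulnC // ltnW.
by rewrite ltn_divLR 1?mulnC // ltnW.
Qed.

(* No carry occurs at the trailing zero digits of [a]. *)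
Lemma carries_le_sub (p f a b d v : nat) : (1 < p)%N ->
  (p ^ v %| a)%N -> (a < p ^ d)%N -> (b < p ^ d)%N -> (v <= d)%N ->
  (carries p f a b false <= d - v)%N.
Proof.
move=> p_gt1; have p_gt0 := ltnW p_gt1.
elim: v f a b d => [|v IHv] f a b d; first by rewrite subn0 => *; apply: carries_le_digits.
case: d => // d; case: f => //= f /dvdnP[a' ->] ha hb le_vd.
rewrite expnS mulnCA modnMr add0n addn0 (leqNgt p) ltn_mod p_gt0 /= add0n mulKn //.
rewrite subSS; apply: IHv => //; first by rewrite dvdn_mull.
  by move: ha; rewrite !expnS mulnCA ltn_pmul2l.
by rewrite ltn_divLR // mulnC -expnS.
Qed.

(** * Divisibility by powers of [p] among the rationals *)

(* [p ^ e] divides [a] in the localization of the integers at [p]. *)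
Definition pdvd (p e : nat) (a : rat) : Prop :=
  exists m : nat, ~~ (p %| m)%N /\ exists z : int, m%:R * a = (p ^ e)%:R * z%:~R.

Lemma pdvd_int (p : nat) (z : int) : prime p -> pdvd p 0 z%:~R.
Proof.
by move=> /prime_gt1 h; exists 1%N; split; [rewrite dvdn1; lia | exists z; rewrite expn0 !mul1r].
Qed.

Lemma pdvd0 (p e : nat) : prime p -> pdvd p e 0.
Proof.
by move=> /prime_gt1 h; exists 1%N; split; [rewrite dvdn1; lia | exists 0; rewrite !mulr0].
Qed.

Lemma pdvdD (p e : nat) (a b : rat) : prime p ->
  pdvd p e a -> pdvd p e b -> pdvd p e (a + b).
Proof.
move=> p_pr [m [pm [z ez]]] [n [pn [y ey]]]; exists (m * n)%N; split.
  by rewrite Euclid_dvdM // negb_or pm.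
exists (z *+ n + y *+ m); rewrite natrM mulrDr.
rewrite mulrAC ez -(mulrA m%:R) ey rmorphD !rmorphMn /=; ring.
Qed.

Lemma pdvdM (p e f : nat) (a b : rat) : prime p ->
  pdvd p e a -> pdvd p f b -> pdvd p (e + f) (a * b).
Proof.
move=> p_pr [m [pm [z ez]]] [n [pn [y ey]]]; exists (m * n)%N; split.
  by rewrite Euclid_dvdM // negb_or pm.
exists (z * y); rewrite natrM mulrACA ez ey expnD natrM rmorphM /=; ring.
Qed.

Lemma pdvd_le (p e f : nat) (a : rat) : (e <= f)%N -> pdvd p f a -> pdvd p e a.
Proof.
move=> le_ef [m [pm [z ez]]]; exists m; split=> //.
exists ((p ^ (f - e))%:Z * z).
by rewrite ez rmorphM mulrA -natrM -expnD subnKC.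
Qed.

Lemma pdvd_nat (p e m : nat) : prime p -> (p ^ e %| m)%N -> pdvd p e m%:R.
Proof.
move=> p_pr /dvdnP[k ->]; have h := prime_gt1 p_pr.
exists 1%N; split; first by rewrite dvdn1; lia.
by exists k%:Z; rewrite mul1r natrM mulrC.
Qed.

(** Here [c = u p^v] with [u] prime to [p]: [|u|] is absorbed by the denominator, the sign of [u] by
    the numerator. *)
Lemma pdvd_cancel (p v e : nat) (c : int) (a : rat) : prime p ->
  ~~ ((p ^ v.+1)%:Z %| c)%Z -> ((p ^ v)%:Z %| c)%Z ->
  pdvd p (v + e) (c%:~R * a) -> pdvd p e a.
Proof.
move=> p_pr ndvd /dvdzP[u def_c] [m [pm [z ez]]].
have p_gt0 := prime_gt0 p_pr.
exists (m * `|u|)%N; split.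
  rewrite Euclid_dvdM // negb_or pm /=; apply: contra ndvd => pu.
  by rewrite def_c expnS PoszM dvdz_mul.
have {}ez : m%:R * u%:~R * a = (p ^ e)%:R * z%:~R.
  apply: (mulfI (x := (p ^ v)%:R)); first by rewrite pnatr_eq0 -lt0n expn_gt0 p_gt0.
  rewrite [RHS]mulrA -natrM -expnD -ez def_c rmorphM /=.
  rewrite [(_%:Z)%:~R]/= ; ring.
exists (sgz u * z); rewrite natrM rmorphM /=.
have -> : `|u|%:R = (sgz u)%:~R * u%:~R :> rat.
  by rewrite -rmorphM /= -abszEsg.
by rewrite [RHS]mulrCA -ez; ring.
Qed.

(** The quotient [m / n] is a p-adic unit, so a factorial in a denominator can be traded for any
    number of the same order. *)
Lemma pdvd_div_fact (p n m : nat) (a : rat) : prime p ->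
  logn p n = logn p m -> (0 < n)%N -> (0 < m)%N ->
  pdvd p 0 (a / m%:R) -> pdvd p 0 (a / n%:R).
Proof.
move=> p_pr eq_log n_gt0 m_gt0 h.
pose e := logn p n.
have [k pk def_n] := pfactor_coprime p_pr n_gt0.
have [j pj def_m] := pfactor_coprime p_pr m_gt0.
rewrite prime_coprime // in pk.
have nz : (p ^ e)%:R != 0 :> rat by rewrite pnatr_eq0 -lt0n expn_gt0 prime_gt0.
have kz : k%:R != 0 :> rat by apply: contraNneq pk => /eqP; rewrite pnatr_eq0 => /eqP->.
have jz : j%:R != 0 :> rat.
  by apply: contraTneq m_gt0 => /eqP; rewrite pnatr_eq0 def_m => /eqP->; rewrite mul0n.
rewrite (_ : a / n%:R = (j%:R / k%:R) * (a / m%:R)).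
  apply: (pdvdM _ 0 0) => //; exists k; split=> //; exists j%:Z.
  by rewrite expn0 mul1r mulrC divfK.
rewrite def_n def_m -eq_log -/e !natrM.
by field; rewrite nz kz jz.
Qed.

(** The orders are compared after clearing denominators. Zero is excluded because [ordp p 0]
    evaluates to 0 instead of infinity. *)
Lemma pdvd_ordp (p e : nat) (a : rat) : prime p -> a != 0 ->
  pdvd p e a -> e%:Z <= ordp p a.
Proof.
move=> p_pr a0 [m [pm [z ez]]].
have m0 : (0 < m)%N by case: m pm {ez} => //; rewrite dvdn0.
have Ez : numq a * m%:Z = denq a * z * (p ^ e)%:Z.
  apply: (@intr_inj rat); rewrite !rmorphM /= -[RHS]mulrA [X in _ = _ * X]mulrC -ez.
  by rewrite numqE -pmulrn; ring.
have z0 : z != 0.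
  apply/eqP => z0; move: Ez; rewrite z0 mulr0 mul0r => /eqP.
  by rewrite mulf_eq0 numq_eq0 (negPf a0) /= eqz_nat -leqn0 leqNgt m0.
have {}Ez : (`|numq a| * m = `|denq a| * `|z| * p ^ e)%N.
  by have /(congr1 absz) := Ez; rewrite !abszM.
have p0 : (0 < p ^ e)%N by rewrite expn_gt0 prime_gt0.
have /(congr1 (logn p)) := Ez.
rewrite !lognM ?muln_gt0 ?absz_gt0 ?numq_eq0 ?denq_neq0 ?z0 //.
rewrite pfactorK // (logn_coprime (m := m)) ?prime_coprime // addn0.
by rewrite /ordp; lia.
Qed.

(** * Linear functionals on polynomials *)

Definition pairing (e : nat -> rat) (f : {poly rat}) : rat :=
  \sum_(k < size f) f`_k * e k.

Lemma pairingE (e : nat -> rat) (f : {poly rat}) (N : nat) :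
  (size f <= N)%N -> pairing e f = \sum_(k < N) f`_k * e k.
Proof.
move=> le_N; rewrite /pairing (big_ord_widen N (fun k => f`_k * e k)) // big_mkcond.
by apply: eq_bigr => k _; case: ltnP => // h; rewrite nth_default // mul0r.
Qed.

Lemma pairingD (e : nat -> rat) (f g : {poly rat}) :
  pairing e (f + g) = pairing e f + pairing e g.
Proof.
pose N := maxn (size f) (size g).
rewrite !(pairingE _ _ N) ?leq_maxl ?leq_maxr ?size_polyD // -big_split.
by apply: eq_bigr => k _; rewrite coefD mulrDl.
Qed.

Lemma pairingZ (e : nat -> rat) (c : rat) (f : {poly rat}) :
  pairing e (c *: f) = c * pairing e f.
Proof.
rewrite !(pairingE _ _ (size f)) ?size_scale_leq // mulr_sumr.
by apply: eq_bigr => k _; rewrite coefZ mulrA.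
Qed.

Lemma pairingB (e : nat -> rat) (f g : {poly rat}) :
  pairing e (f - g) = pairing e f - pairing e g.
Proof. by rewrite -scaleN1r pairingD pairingZ mulN1r. Qed.

Lemma pairing_mulXn (e : nat -> rat) (j : nat) (f : {poly rat}) :
  pairing e (f * 'X^j) = pairing (fun k => e (k + j)%N) f.
Proof.
rewrite (pairingE _ _ (j + size f)); last first.
  by rewrite (leq_trans (size_polyMleq _ _)) // size_polyXn addnS addnC.
rewrite big_split_ord /= big1 ?add0r.
  by apply: eq_bigr => k _; rewrite coefMXn ltnNge leq_addr /= addKn addnC.
by move=> k _; rewrite coefMXn ltn_ord mul0r.
Qed.

Lemma pairing_lin (e e1 e2 : nat -> rat) (a b : rat) (f : {poly rat}) :
  (forall k, e k = a * e1 k + b * e2 k) ->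
  pairing e f = a * pairing e1 f + b * pairing e2 f.
Proof.
move=> he; rewrite /pairing !mulr_sumr -big_split; apply: eq_bigr => k _ /=.
by rewrite he; ring.
Qed.

Lemma eq_pairing (e e' : nat -> rat) (f : {poly rat}) :
  e =1 e' -> pairing e f = pairing e' f.
Proof. by move=> h; apply: eq_bigr => k _; rewrite h. Qed.

Lemma pairing_deriv (e : nat -> rat) (f : {poly rat}) :
  pairing e (f^`() * 'X) = pairing (fun k => k%:R * e k) f.
Proof.
rewrite (pairingE _ _ (size f)); last first.
  case: (eqVneq f 0) => [->|nz_f]; first by rewrite deriv0 mul0r.
  by rewrite (leq_trans (size_polyMleq _ _)) // size_polyX addn2 /= lt_size_deriv.
apply: eq_bigr => -[[|k] lt_k] _ /=; rewrite coefMX /=; first by rewrite !mul0r mulr0.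
by rewrite coef_deriv -mulr_natr; ring.
Qed.

(** * Scaled falling factorials and the weights defining D_{l,r} *)

(** This is [l! p^l] times the binomial coefficient of [a] over [l], the form in which it enters
    [T]. *)
Definition pfall (p l : nat) (a : int) : rat :=
  \prod_(i < l) (p%:R * (a%:~R - i%:R)).

Lemma pfall_int (p l : nat) (a : int) : exists z : int, pfall p l a = z%:~R.
Proof.
exists (\prod_(i < l) (p%:Z * (a - i%:Z))).
by rewrite rmorph_prod; apply: eq_bigr => i _; rewrite rmorphM rmorphB.
Qed.

Lemma pfallS (p l : nat) (a : int) :
  pfall p l.+1 a = pfall p l a * (p%:R * (a%:~R - l%:R)).
Proof. by rewrite /pfall big_ord_recr. Qed.

(** Both values of [pfall] at [l.+1] share the factors of [pfall p l a]; the remaining ones,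
    [p (a + 1)] and [p (a - l)], differ by [p (l + 1)]. *)
Lemma pfall_diff (p l : nat) (a : int) :
  pfall p l.+1 (a + 1) = pfall p l.+1 a + (p * l.+1)%:R * pfall p l a.
Proof.
rewrite (pfallS p l a) /pfall big_ord_recl /=.
rewrite (eq_bigr (fun i : 'I_l => p%:R * (a%:~R - i%:R))); last first.
  by move=> i _; rewrite /bump leq0n rmorphD natrD /=; congr (_ * _); ring.
rewrite rmorphD natrM -[l.+1]addn1 natrD /=; ring.
Qed.

(* [Q] stands for p^alpha, and [r] is any integer representative. *)
Definition weight (p Q l : nat) (r : int) (k : nat) : rat :=
  if (k%:Z == r %[mod Q%:Z])%Z then pfall p l ((k%:Z - r) %/ Q%:Z)%Z else 0.

Lemma weight_int (p Q l : nat) (r : int) (k : nat) :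
  exists z : int, weight p Q l r k = z%:~R.
Proof. by rewrite /weight; case: ifP => _; [apply: pfall_int | exists 0]. Qed.

Lemma weight_shift (p Q l j : nat) (r : int) (k : nat) :
  weight p Q l r (k + j) = weight p Q l (r - j%:Z) k.
Proof.
rewrite /weight !eqz_mod_dvd.
by have -> : (k + j)%N%:Z - r = k%:Z - (r - j%:Z) by rewrite PoszD; ring.
Qed.

Lemma weight_addQ0 (p Q : nat) (r : int) (k : nat) :
  weight p Q 0 r (k + Q) = weight p Q 0 r k.
Proof.
by rewrite /weight /pfall !big_ord0 PoszD modzDr.
Qed.

Lemma weight_addQS (p Q l : nat) (r : int) (k : nat) : (0 < Q)%N ->
  weight p Q l.+1 r (k + Q) = weight p Q l.+1 r k + (p * l.+1)%:R * weight p Q l r k.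
Proof.
move=> Q_gt0; rewrite /weight PoszD modzDr; case: ifP => _; last by rewrite mulr0 addr0.
rewrite -pfall_diff; congr pfall.
have -> : k%:Z + Q%:Z - r = 1 * Q%:Z + (k%:Z - r) by ring.
have nzQ : Q%:Z != 0 by case: (Q) Q_gt0.
by rewrite divzMDl // [LHS]addrC.
Qed.

(** With [k = r + p q a], write [k = (r + p q l) + q * p (a - l)]; the factor [p (a - l)] raises [l]
    by one. *)
Lemma weight_mulk (p q l : nat) (r : int) (k : nat) :
  k%:R * weight p (p * q) l r k =
  (r%:~R + (p * q * l)%:R) * weight p (p * q) l r k + q%:R * weight p (p * q) l.+1 r k.
Proof.
rewrite /weight eqz_mod_dvd; case: ifP => [/divzK def_k|_]; last by rewrite !mulr0 addr0.
move: def_k; set a := (_ %/ _)%Z => def_k.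
have -> : k%:R = r%:~R + a%:~R * (p * q)%:R :> rat.
  have -> : k%:R = (k%:Z)%:~R :> rat by [].
  rewrite -[k%:Z](subrK r) -def_k rmorphD rmorphM /=; exact: addrC.
by rewrite pfallS !natrM; ring.
Qed.

(** * Integral polynomials and their multipliers *)

Definition Dcoef (p Q l : nat) (r : int) (f : {poly rat}) : rat :=
  pairing (weight p Q l r) f.

Definition Dint (p Q : nat) (f : {poly rat}) : Prop :=
  forall l r, pdvd p 0 (Dcoef p Q l r f).

(** Multipliers compose, so this notion is closed under products by construction; applied to 1 it
    yields [Dint]. *)
Definition Dmult (p Q : nat) (f : {poly rat}) : Prop :=
  forall g, Dint p Q g -> Dint p Q (f * g).

Lemma Dint1 (p Q : nat) : prime p -> Dint p Q 1.
Proof.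
move=> p_pr l r; rewrite /Dcoef /pairing size_poly1 big_ord1 coef1 mul1r.
by have [z ->] := weight_int p Q l r 0; apply: pdvd_int.
Qed.

Lemma Dmult_int (p Q : nat) (f : {poly rat}) : prime p -> Dmult p Q f -> Dint p Q f.
Proof. by move=> p_pr Mf; rewrite -[f]mulr1; apply: Mf; apply: Dint1. Qed.

Lemma DmultD (p Q : nat) (f g : {poly rat}) : prime p ->
  Dmult p Q f -> Dmult p Q g -> Dmult p Q (f + g).
Proof.
move=> p_pr Mf Mg h Ih l r; rewrite mulrDl /Dcoef pairingD.
by apply: pdvdD; [| apply: Mf | apply: Mg].
Qed.

Lemma DmultM (p Q : nat) (f g : {poly rat}) :
  Dmult p Q f -> Dmult p Q g -> Dmult p Q (f * g).
Proof. by move=> Mf Mg h Ih; rewrite -mulrA; apply/Mf/Mg. Qed.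

Lemma Dmult1 (p Q : nat) : Dmult p Q 1.
Proof. by move=> h; rewrite mul1r. Qed.

Lemma DmultXn (p Q : nat) (f : {poly rat}) n : Dmult p Q f -> Dmult p Q (f ^+ n).
Proof.
by move=> Mf; elim: n => [|n IHn]; [apply: Dmult1 | rewrite exprS; apply: DmultM].
Qed.

Lemma DmultC (p Q : nat) (c : rat) : prime p -> pdvd p 0 c -> Dmult p Q c%:P.
Proof.
move=> p_pr hc h Ih l r; rewrite mul_polyC /Dcoef pairingZ.
by apply: (pdvdM _ 0 0) => //; apply: Ih.
Qed.

Lemma DmultX (p Q : nat) : Dmult p Q 'X.
Proof.
move=> h Ih l r; rewrite mulrC -['X]expr1 /Dcoef pairing_mulXn.
by rewrite (eq_pairing _ _ _ (weight_shift p Q l 1 r)); apply: Ih.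
Qed.

Lemma Dmult_sum (p Q : nat) (I : Type) (s : seq I) (P : pred I) (F : I -> {poly rat}) :
  prime p -> (forall i, P i -> Dmult p Q (F i)) -> Dmult p Q (\sum_(i <- s | P i) F i).
Proof.
move=> p_pr hF; apply: big_ind => //; last by move=> *; apply: DmultD.
by rewrite -polyC0; apply: DmultC => //; apply: pdvd0.
Qed.

Lemma Dmult_intpoly (p Q : nat) (f : {poly int}) : prime p ->
  Dmult p Q (map_poly intr f).
Proof.
move=> p_pr; elim/poly_ind: f => [|f c IHf].
  by rewrite rmorph0 -polyC0; apply: DmultC => //; apply: pdvd0.
rewrite rmorphD rmorphM /= map_polyX map_polyC /=.
apply: DmultD => //; first exact: DmultM (DmultX _ _).
by apply: DmultC => //; apply: pdvd_int.
Qed.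

(** * Divided powers *)

Definition divpow (p Q : nat) (f : {poly rat}) : Prop :=
  forall m, Dmult p Q ((m`!%:R)^-1 *: f ^+ m).

(** Multiplication by ['X^Q - 1] acts on the weights as a difference with step [Q]. At [l = 0] the
    truncated [l.-1] is killed by the factor [l]. *)
Lemma Dcoef_mulw (p Q l : nat) (r : int) (f : {poly rat}) : (0 < p)%N -> (0 < Q)%N ->
  Dcoef p Q l r (p%:R^-1 *: ('X^Q - 1) * f) = l%:R * Dcoef p Q l.-1 r f.
Proof.
move=> p_gt0 Q_gt0; rewrite /Dcoef -scalerAl pairingZ [_ * f]mulrC mulrBr mulr1 pairingB.
rewrite pairing_mulXn.
have pz : p%:R != 0 :> rat by rewrite pnatr_eq0 -lt0n.
case: l => [|l] /=.
  by rewrite (eq_pairing _ _ _ (weight_addQ0 p Q r)) subrr mulr0 mul0r.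
rewrite (pairing_lin _ (weight p Q l.+1 r) (weight p Q l r) 1 (p * l.+1)%:R).
  by rewrite natrM; field.
by move=> k; rewrite mul1r weight_addQS.
Qed.

Lemma Dcoef_mulwX (p Q l m : nat) (r : int) (f : {poly rat}) : (0 < p)%N -> (0 < Q)%N ->
  Dcoef p Q l r ((p%:R^-1 *: ('X^Q - 1)) ^+ m * f) = (l ^_ m)%:R * Dcoef p Q (l - m) r f.
Proof.
move=> p_gt0 Q_gt0; elim: m l => [|m IHm] l; first by rewrite expr0 !mul1r subn0.
rewrite exprS -mulrA Dcoef_mulw // IHm ffactnS natrM mulrA.
by rewrite -subn1 -subnDA add1n.
Qed.

(** The falling factorial [l ^_ m] divided by [m!] is a binomial coefficient, hence integral. *)
Lemma divpow_w (p Q : nat) : prime p -> (0 < Q)%N ->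
  divpow p Q (p%:R^-1 *: ('X^Q - 1)).
Proof.
move=> p_pr Q_gt0 m h Ih l r; have p_gt0 := prime_gt0 p_pr.
rewrite -scalerAl {1}/Dcoef pairingZ -/(Dcoef _ _ _ _ _) Dcoef_mulwX //.
rewrite -bin_ffact natrM mulrA mulrCA mulVf ?mulr1; last by rewrite pnatr_eq0 -lt0n fact_gt0.
exact: (pdvdM _ 0 0 _ _ p_pr (pdvd_nat _ 0 _ p_pr (dvd1n _)) (Ih _ _)).
Qed.

Lemma logn_fact_mul (p n : nat) : prime p ->
  logn p n`! = logn p (p ^ (n %/ p) * (n %/ p)`!)%N.
Proof.
move=> p_pr; have p_gt0 := prime_gt0 p_pr.
by rewrite (legendre_step p n) // lognM ?expn_gt0 ?p_gt0 ?fact_gt0 // pfactorK.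
Qed.

Lemma logn_fact_le (p n : nat) : prime p -> (logn p n`! <= n)%N.
Proof.
move=> p_pr; elim/ltn_ind: n => -[|n] IHn; first by rewrite logn1.
have p_gt1 := prime_gt1 p_pr.
rewrite legendre_step // (leq_trans (leq_add (leqnn _) (IHn _ _))) ?ltn_Pdiv //.
rewrite addnn -mul2n mulnC (leq_trans _ (leq_trunc_div n.+1 p)) //.
by rewrite leq_mul2l p_gt1 orbT.
Qed.

Lemma Dmult_factE (p Q n m : nat) (f : {poly rat}) : prime p ->
  logn p n = logn p m -> (0 < n)%N -> (0 < m)%N ->
  Dmult p Q (m%:R^-1 *: f) -> Dmult p Q (n%:R^-1 *: f).
Proof.
move=> p_pr eq_log n_gt0 m_gt0 Mf.
have nz : m%:R != 0 :> rat by rewrite pnatr_eq0 -lt0n.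
have -> : n%:R^-1 *: f = (m%:R / n%:R)%:P * (m%:R^-1 *: f).
  by rewrite mul_polyC scalerA mulrAC mulfV // mul1r.
apply: DmultM => //; apply: DmultC => //; apply: (pdvd_div_fact _ _ m) => //.
by rewrite divff //; apply: (pdvd_int p 1).
Qed.

(** Binomial theorem for divided powers. Assuming only exponents up to [m] makes it usable inside a
    strong induction. *)
Lemma Dmult_dividedD (p Q m : nat) (f g : {poly rat}) : prime p ->
  (forall i, (i <= m)%N -> Dmult p Q ((i`!%:R)^-1 *: f ^+ i)) ->
  (forall i, (i <= m)%N -> Dmult p Q ((i`!%:R)^-1 *: g ^+ i)) ->
  Dmult p Q ((m`!%:R)^-1 *: (f + g) ^+ m).
Proof.
move=> p_pr Mf Mg; rewrite exprDn scaler_sumr; apply: Dmult_sum => // i _.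
have le_im : (i <= m)%N by rewrite -ltnS.
have factz j : j`!%:R != 0 :> rat by rewrite pnatr_eq0 -lt0n fact_gt0.
have -> : m`!%:R^-1 *: (f ^+ (m - i) * g ^+ i *+ 'C(m, i)) =
  ((m - i)`!%:R^-1 *: f ^+ (m - i)) * (i`!%:R^-1 *: g ^+ i).
  rewrite -scaler_nat scalerA -scalerAl -scalerAr scalerA; congr (_ *: _).
  have binz : 'C(m, i)%:R != 0 :> rat by rewrite pnatr_eq0 -lt0n bin_gt0.
  by rewrite -(bin_fact le_im) !natrM; field; rewrite binz !factz.
by apply: DmultM; [apply: Mf; apply: leq_subr | apply: Mg].
Qed.

Lemma divpowD (p Q : nat) (f g : {poly rat}) : prime p ->
  divpow p Q f -> divpow p Q g -> divpow p Q (f + g).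
Proof. by move=> p_pr df dg m; apply: Dmult_dividedD. Qed.

(** The order of [m!] is at most [m], so [p^m / m!] is p-integral. *)
Lemma divpow_prime (p Q : nat) (g : {poly rat}) : prime p ->
  Dmult p Q g -> divpow p Q (p%:R * g).
Proof.
move=> p_pr Mg m; rewrite exprMn -natrX -polyC_natr mul_polyC scalerA -mul_polyC.
apply: DmultM; last exact: DmultXn.
apply: DmultC => //; rewrite mulrC.
have pe_gt0 : (0 < p ^ logn p m`!)%N by rewrite expn_gt0 prime_gt0.
apply: (pdvd_div_fact _ _ (p ^ logn p m`!)) => //; rewrite ?pfactorK ?fact_gt0 //.
have -> : (p ^ m = p ^ (m - logn p m`!) * p ^ logn p m`!)%N.
  by rewrite -expnD subnK // logn_fact_le.
rewrite natrM mulfK; first by apply: (pdvd_nat p 0); rewrite ?dvd1n.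
by rewrite pnatr_eq0 -lt0n.
Qed.

(** * Frobenius congruences and powers of [1 - 'X] *)

(** Every middle binomial term is divisible by [p] and also by [u]; keeping the factor [u] is what
    later exposes divided powers of [u]. *)
Lemma frobenius_add (R : comNzRingType) (p : nat) (u v : R) : prime p ->
  exists c : R, (u + v) ^+ p = u ^+ p + v ^+ p + p%:R * (u * c).
Proof.
case: p => // p p_pr.
exists (\sum_(i < p) u ^+ (p - i.+1) * v ^+ i.+1 *+ ('C(p.+1, i.+1) %/ p.+1)).
rewrite exprDn big_ord_recl big_ord_recr /= subn0 subnn expr0 mulr1 mul1r !mulr1n.
rewrite /bump /= add1n binn ?mulr1n. rewrite -addrA; congr (_ + _); rewrite addrC; congr (_ + _).
rewrite !mulr_sumr; apply: eq_bigr => i _; rewrite add1n.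
have /divnK {1}<- : (p.+1 %| 'C(p.+1, i.+1))%N by rewrite prime_dvd_bin //= ltnS.
rewrite subSn // exprS -[LHS]mulr_natr -[_ *+ (_ %/ _)]mulr_natr natrM; ring.
Qed.

Lemma frobenius_expX (p q : nat) : prime p -> exists c : {poly int},
  ('X^q - 1) ^+ p = 'X^(p * q) - 1 - p%:R * (('X^q - 1) * c).
Proof.
move=> p_pr; have [c def_c] := frobenius_add _ _ ('X^q - 1 : {poly int}) 1 p_pr.
exists c; move: def_c; rewrite subrK expr1n mulnC exprM => ->; ring.
Qed.

Lemma frobenius_Xsub1 (p a : nat) : prime p -> exists g : {poly int},
  ('X - 1) ^+ (p ^ a) = 'X^(p ^ a) - 1 + p%:R * g.
Proof.
move=> p_pr; elim: a => [|a [g IHa]]; first by exists 0; rewrite mulr0 addr0 !expr1.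
have [c def_c] := frobenius_expX p (p ^ a) p_pr.
rewrite expnSr exprM IHa.
have [d ->] := frobenius_add _ p ('X^(p ^ a) - 1) (p%:R * g) p_pr.
set u := 'X^(p ^ a) - 1 in def_c *.
exists (u * d - u * c + p%:R ^+ p.-1 * g ^+ p).
have -> : (p%:R * g) ^+ p = p%:R * (p%:R ^+ p.-1 * g ^+ p).
  by rewrite exprMn mulrA -exprS prednK ?prime_gt0.
rewrite [(p ^ a * p)%N]mulnC def_c -/u; ring.
Qed.

(* u^(pm) / (p^m m!) = (w - u c)^m / m!, and only divided powers of [u] of
   exponent at most [m < n] occur in its expansion. *)
Lemma divpow_X (p q : nat) : prime p -> (0 < q)%N -> divpow p (p * q) ('X^q - 1).
Proof.
move=> p_pr q_gt0; have p_gt0 := prime_gt0 p_pr.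
have [c def_c] := frobenius_expX p q p_pr.
elim/ltn_ind => n IHn; have [->|n_gt0] := posnP n.
  by rewrite expr0 invr1 scale1r; apply: Dmult1.
apply: (Dmult_factE _ _ _ (p ^ (n %/ p) * (n %/ p)`!)); rewrite ?fact_gt0 //.
- exact: logn_fact_mul.
- by rewrite muln_gt0 fact_gt0 expn_gt0 p_gt0.
(* The leftover power, of exponent [n %% p], has integer coefficients and is a multiplier without
   any division. *)
rewrite [in X in _ *: X](divn_eq n p) exprD scalerAl.
set m := (n %/ p)%N.
apply: DmultM; last first.
  apply: DmultXn; have -> : 'X^q - 1 = map_poly intr ('X^q - 1 : {poly int}) :> {poly rat}.
    by rewrite rmorphB rmorph1 /= map_polyXn.
  exact: Dmult_intpoly.
pose C := map_poly intr (- c) : {poly rat}.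
have pz : p%:R != 0 :> rat by rewrite pnatr_eq0 -lt0n.
have -> : (p ^ m * m`!)%:R^-1 *: ('X^q - 1) ^+ (m * p) =
   m`!%:R^-1 *: (p%:R^-1 *: ('X^(p * q) - 1) + C * ('X^q - 1)) ^+ m :> {poly rat}.
  have -> : C * ('X^q - 1) = p%:R^-1 *: (('X^q - 1) ^+ p - ('X^(p * q) - 1)).
    have /(congr1 (map_poly (intr : int -> rat))) := def_c.
    rewrite !(rmorphXn, rmorphB, rmorphM, rmorph1, rmorph_nat) /= !map_polyX => ->.
    rewrite addrAC subrr add0r mulr_natl -scaler_nat scalerN scalerA mulVf // scale1r.
    by rewrite /C rmorphN /= mulNr mulrC.
  rewrite -scalerDr addrCA subrr addr0 exprZn scalerA -exprM [(m * p)%N]mulnC natrM natrX.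
  congr (_ *: _).
  by rewrite invfM exprVn mulrC.
apply: Dmult_dividedD => // i le_im.
  by apply: divpow_w; rewrite ?muln_gt0 ?p_gt0.
rewrite exprMn scalerAr; apply: DmultM; first by apply: DmultXn; apply: Dmult_intpoly.
apply: IHn; apply: leq_ltn_trans le_im _; exact: ltn_Pdiv (prime_gt1 p_pr) _.
Qed.

(** Up to sign, this is a divided power of [('X - 1) ^+ (p ^ a)] times the integral polynomial
    [('X - 1) ^+ (n %% p ^ a)]. *)
Lemma Dmult_expr1subX (p a n : nat) : prime p ->
  Dmult p (p ^ a.+1) (((n %/ p ^ a)`!%:R)^-1 *: (1 - 'X) ^+ n).
Proof.
move=> p_pr; have q_gt0 : (0 < p ^ a)%N by rewrite expn_gt0 prime_gt0.
have [g def_g] := frobenius_Xsub1 p a p_pr.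
have Mx : Dmult p (p ^ a.+1) ('X - 1).
  have -> : 'X - 1 = map_poly intr ('X - 1 : {poly int}) :> {poly rat}.
    by rewrite rmorphB rmorph1 /= map_polyX.
  exact: Dmult_intpoly.
rewrite -opprB exprNn scalerAr; apply: DmultM.
  by apply: DmultXn; rewrite -polyCN; apply: DmultC => //; apply: (pdvd_int p (-1)).
rewrite {2}(divn_eq n (p ^ a)) exprD scalerAl mulnC exprM.
apply: DmultM; last exact: DmultXn.
have -> : ('X - 1) ^+ (p ^ a) = 'X^(p ^ a) - 1 + p%:R * map_poly intr g :> {poly rat}.
  have /(congr1 (map_poly (intr : int -> rat))) := def_g.
  by rewrite !(rmorphXn, rmorphB, rmorphD, rmorphM, rmorph1, rmorph_nat) /= !map_polyX.
rewrite expnS; apply: divpowD => //; first exact: divpow_X.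
by apply: divpow_prime => //; apply: Dmult_intpoly.
Qed.

(** The case [alpha = 0]: [(p n)!] has the order of [p^n n!], which leaves a divided power of
    [('X - 1) / p], the [w] for [Q = 1]. *)
Lemma Dmult_expr1subX0 (p n : nat) : prime p ->
  Dmult p 1 (((p * n)`!%:R)^-1 *: (1 - 'X) ^+ n).
Proof.
move=> p_pr; have p_gt0 := prime_gt0 p_pr.
apply: (Dmult_factE _ _ _ (p ^ n * n`!)); rewrite ?fact_gt0 //.
- by rewrite logn_fact_mul // mulKn.
- by rewrite muln_gt0 fact_gt0 expn_gt0 p_gt0.
rewrite -opprB exprNn scalerAr; apply: DmultM.
  by apply: DmultXn; rewrite -polyCN; apply: DmultC => //; apply: (pdvd_int p (-1)).
have -> : (p ^ n * n`!)%:R^-1 *: ('X - 1) ^+ n =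
   n`!%:R^-1 *: (p%:R^-1 *: ('X^1 - 1)) ^+ n :> {poly rat}.
  by rewrite exprZn scalerA natrM natrX invfM exprVn mulrC.
exact: divpow_w.
Qed.

(** * [T] as a value of D_{l,r}, and its recurrence *)

Lemma T_Dcoef (p alpha l n : nat) (r : int) :
  T p alpha l n r =
  ((floor_pm1 p alpha n)`!%:R)^-1 * Dcoef p (p ^ alpha) l r ((1 - 'X) ^+ n).
Proof.
have def_f : (1 - 'X) ^+ n = \poly_(i < n.+1) ('C(n, i)%:R * (-1) ^+ i) :> {poly rat}.
  rewrite poly_def exprBn; apply: eq_bigr => i _.
  rewrite expr1n mulr1 -mul_polyC rmorphM rmorphXn rmorphN1 /= polyC_natr.
  by rewrite -mulr_natl mulrA.
rewrite /Dcoef def_f (pairingE _ _ n.+1) ?size_poly // /T.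
rewrite [_ / _]mulrC -mulrA; congr (_ * _).
rewrite big_mkord mulr_sumr [LHS]big_mkcond; apply: eq_bigr => k _.
rewrite coef_poly ltn_ord /weight; case: ifP => _; last by rewrite mulr0.
rewrite /gbinom /pfall big_split /= prodr_const card_ord natrX.
have lz : l`!%:R != 0 :> rat by rewrite pnatr_eq0 -lt0n fact_gt0.
by field.
Qed.

Lemma Dcoef_expr1subX_rec (p q l n : nat) (r : int) :
  (r%:~R + (p * q * l)%:R) * Dcoef p (p * q) l r ((1 - 'X) ^+ n) =
  - (q%:R * Dcoef p (p * q) l.+1 r ((1 - 'X) ^+ n)
     + n%:R * Dcoef p (p * q) l (r - 1) ((1 - 'X) ^+ n.-1)).
Proof.
have := pairing_deriv (weight p (p * q) l r) ((1 - 'X) ^+ n).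
rewrite (pairing_lin (fun k => _) _ _ _ _ _ (weight_mulk p q l r)).
have -> : ((1 - 'X) ^+ n)^`() * 'X = (- n%:R) *: ((1 - 'X) ^+ n.-1 * 'X^1) :> {poly rat}.
  rewrite deriv_exp derivB derivX -polyC1 derivC sub0r mulN1r polyC1 scaleNr scaler_nat.
  by rewrite mulNrn mulNr mulrnAl.
rewrite pairingZ pairing_mulXn (eq_pairing _ _ _ (weight_shift p (p * q) l 1 r)).
by rewrite /Dcoef => E; rewrite opprD -[X in _ = _ + X]mulNr E; ring.
Qed.

(** * Carries and residues under a unit step *)

(** Kummer's theorem for [a, b] and for [a.-1, b]: the factorials involved differ by the factors [a]
    and [a + b]. *)
Lemma tau_pred (p a b : nat) : prime p -> (0 < a)%N ->
  (logn p a + tau p a b = logn p (a + b) + tau p a.-1 b)%N.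
Proof.
move=> p_pr; case: a => // a _; have := tau_logn p a b p_pr; have := tau_logn p a.+1 b p_pr.
by rewrite addSn !factS !lognM ?fact_gt0 //=; lia.
Qed.

Lemma tau_le (p a b d : nat) : prime p -> (0 < a)%N -> (a < p ^ d)%N -> (b < p ^ d)%N ->
  (logn p a + tau p a b <= d)%N.
Proof.
move=> p_pr a_gt0 ha hb; have p_gt1 := prime_gt1 p_pr.
have le_v : (logn p a <= d)%N.
  rewrite -(leq_exp2l _ _ p_gt1); apply: leq_trans (ltnW ha).
  by apply: dvdn_leq => //; apply: pfactor_dvdnn.
have := carries_le_sub p (a + b).+1 a b d (logn p a) p_gt1 (pfactor_dvdnn _ _) ha hb le_v.
by rewrite -/(tau p a b); lia.
Qed.

(** The quotient drops only when [q] divides [n]; the factorial then loses the factor [n / q]. *)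
Lemma floor_fact_pred (q n : nat) : (0 < n)%N ->
  (n * (n.-1 %/ q)`! = (if q %| n then q else n) * (n %/ q)`!)%N.
Proof.
move=> n_gt0; rewrite divn_pred; case: ifP => [/dvdnP[m def_n]|_]; last by rewrite subn0.
have [q_gt0 m_gt0] : (0 < q)%N /\ (0 < m)%N by apply/andP; rewrite andbC -muln_gt0 -def_n.
by case: m m_gt0 def_n => // m _ ->; rewrite mulnK // subn1 factS mulnCA mulnA.
Qed.

Lemma frac_pm1E (p a : nat) (x : int) : prime p ->
  (frac_pm1 p a.+1 x)%:Z = (x %% (p ^ a)%:Z)%Z.
Proof.
move=> p_pr; rewrite /frac_pm1 gez0_abs // modz_ge0 //.
by rewrite eqz_nat -lt0n expn_gt0 prime_gt0.
Qed.

Lemma frac_pm1_lt (p a : nat) (x : int) : prime p -> (frac_pm1 p a.+1 x < p ^ a)%N.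
Proof.
move=> p_pr; rewrite -ltz_nat frac_pm1E // ltz_pmod //.
by rewrite ltz_nat expn_gt0 prime_gt0.
Qed.

Lemma frac_pm1_pred (p a : nat) (x : int) : prime p -> (0 < frac_pm1 p a.+1 x)%N ->
  frac_pm1 p a.+1 (x - 1) = (frac_pm1 p a.+1 x).-1.
Proof.
move=> p_pr x_gt0; apply/eqP; rewrite -eqz_nat frac_pm1E //.
have lt_x := frac_pm1_lt p a x p_pr.
have -> : ((x - 1) %% (p ^ a)%:Z)%Z = (((frac_pm1 p a.+1 x)%:Z - 1) %% (p ^ a)%:Z)%Z.
  by rewrite frac_pm1E // modzDml.
by rewrite modz_small; lia.
Qed.

Lemma frac_pm1_dvd (p a e n : nat) (r : int) : prime p -> (e <= a)%N ->
  (p ^ e %| frac_pm1 p a.+1 r + frac_pm1 p a.+1 (n%:Z - r))%N = (p ^ e %| n)%N.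
Proof.
move=> p_pr le_ea; have dvd_q : (p ^ e %| p ^ a)%N by apply: dvdn_exp2l.
suff E : (frac_pm1 p a.+1 r + frac_pm1 p a.+1 (n%:Z - r))%N = n %[mod p ^ a].
  by rewrite /dvdn -(modn_dvdm _ dvd_q) E modn_dvdm.
apply/eqP; rewrite -eqz_nat -!modz_nat PoszD !frac_pm1E // modzDm.
by rewrite addrC subrK.
Qed.

(** * The carry bound by induction on [n] *)

Lemma pdvd_T (p a l n : nat) (r : int) : prime p ->
  pdvd p (tau p (frac_pm1 p a.+1 r) (frac_pm1 p a.+1 (n%:Z - r))) (T p a.+1 l n r).
Proof.
move=> p_pr; have q_gt0 : (0 < p ^ a)%N by rewrite expn_gt0 prime_gt0.
have T_int k m s : pdvd p 0 (T p a.+1 k m s).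
  rewrite T_Dcoef -pairingZ; exact: Dmult_int (Dmult_expr1subX p a m p_pr) k s.
elim: n l r => [|n IHn] l r.
  set r0 := frac_pm1 _ _ r; have [->|r0_gt0] := posnP r0.
    have := tau_logn p 0 (frac_pm1 p a.+1 (0%:Z - r)) p_pr.
    by rewrite add0n logn1 addn0 => /(canRL (addnK _)); rewrite subnn => ->.
  rewrite T_Dcoef /Dcoef expr0 /pairing size_poly1 big_ord1 coef1 mul1r.
  rewrite /weight; case: ifP => [|_]; last by rewrite mulr0; apply: pdvd0.
  rewrite eq_sym eqz_mod_dvd subr0 expnS PoszM => dvd_r.
  (* A nonzero weight at [k = 0] forces [p ^ a.+1] to divide [r], against [r0 > 0]. *)
  suff : r0 = 0%N by lia.
  apply/eqP; rewrite -eqz_nat frac_pm1E //; apply/eqP/dvdz_mod0P; apply: dvdz_trans dvd_r.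
  exact: dvdz_mull.
set r0 := frac_pm1 _ _ r; set s0 := frac_pm1 _ _ (_ - r).
have [r00|r0_gt0] := posnP r0.
  have := tau_logn p 0 s0 p_pr.
  by rewrite r00 add0n logn1 addn0 => /(canRL (addnK _)); rewrite subnn => ->.
have r0_lt : (r0 < p ^ a)%N by apply: frac_pm1_lt.
have s0_lt : (s0 < p ^ a)%N by apply: frac_pm1_lt.
set v := logn p r0.
have le_tau : (v + tau p r0 s0 <= a)%N by apply: tau_le.
have lt_va : (v < a)%N.
  rewrite -(ltn_exp2l _ _ (prime_gt1 p_pr)); apply: leq_ltn_trans r0_lt.
  by apply: dvdn_leq => //; apply: pfactor_dvdnn.
(* Modulo [p ^ a] the coefficient is congruent to [r0]; as [v < a], its order is exactly [v]. *)
have dvd_c e : (e <= a)%N ->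
    ((p ^ e)%:Z %| r + (p * p ^ a * l)%:Z)%Z = (p ^ e %| r0)%N.
  move=> le_ea; have dvd_q : ((p ^ e)%:Z %| (p ^ a)%:Z)%Z by apply: dvdn_exp2l.
  rewrite rpredDr; last by rewrite -mulnA mulnCA PoszM dvdz_mulr.
  rewrite (divz_eq r (p ^ a)%:Z) -frac_pm1E // rpredDl //.
  by rewrite dvdz_mull.
apply: (pdvd_cancel p v _ (r + (p * p ^ a * l)%:Z)) => //.
- by rewrite dvd_c // pfactor_dvdn // ltnn.
- by rewrite dvd_c ?(ltnW lt_va) // pfactor_dvdnn.
have [N def_N dvd_N] : exists2 N : nat,
    ((n.+1 * (n %/ p ^ a)`!) = N * (n.+1 %/ p ^ a)`!)%N & (p ^ logn p (r0 + s0) %| N)%N.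
  exists (if (p ^ a %| n.+1)%N then (p ^ a)%N else n.+1).
    exact: (floor_fact_pred (p ^ a) n.+1).
  set e := logn p (r0 + s0).
  have dvd_e : (p ^ e %| r0 + s0)%N by apply: pfactor_dvdnn.
  case: ifP => [dvd_n|ndvd_n].
    have dvd_rs : (p ^ a %| r0 + s0)%N by rewrite frac_pm1_dvd.
    have -> : (p ^ a = r0 + s0)%N; last by [].
    (* The sum lies strictly between 0 and [2 p ^ a], so the only possible multiple is [p ^ a]
       itself. *)
    have /dvdnP[[|[|m]] def_rs] := dvd_rs; lia.
  case: (leqP e a) => [le_ea|lt_ae]; first by rewrite frac_pm1_dvd in dvd_e.
  case/negP: ndvd_n; rewrite -(frac_pm1_dvd p a a n.+1 r) // -/r0 -/s0.
  by apply: dvdn_trans dvd_e; apply: dvdn_exp2l; apply: ltnW.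
have factz m : m`!%:R != 0 :> rat by rewrite pnatr_eq0 -lt0n fact_gt0.
have -> : (r + (p * p ^ a * l)%:Z)%:~R * T p a.+1 l n.+1 r =
    - 1%:~R * ((p ^ a)%:R * T p a.+1 l.+1 n.+1 r + N%:R * T p a.+1 l n (r - 1)).
  rewrite !T_Dcoef /floor_pm1 rmorphD /= mulrCA expnS Dcoef_expr1subX_rec.
  have /(congr1 (fun m => m%:R : rat)) := def_N; rewrite !natrM /= => E.
  have -> : N%:R = n.+1%:R * (n %/ p ^ a)`!%:R / (n.+1 %/ p ^ a)`!%:R :> rat.
    by rewrite E mulfK.
  by field; rewrite !factz.
rewrite -[(v + _)%N]add0n; apply: pdvdM => //; first exact: (pdvd_int p (-1)).
apply: pdvdD => //.
  (* The factor [p ^ a] alone suffices here, since [v + tau p r0 s0 <= a]. *)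
  apply: (pdvd_le _ _ (a + 0)); first by rewrite addn0.
  by apply: pdvdM => //; apply: pdvd_nat.
(* [N] supplies the order of [r0 + s0]; the induction hypothesis supplies the carries of [r0.-1] and
   the unchanged [s0]. *)
rewrite /v tau_pred //; apply: pdvdM => //; first exact: pdvd_nat.
have := IHn l (r - 1); rewrite frac_pm1_pred // -/r0.
by have -> : n%:Z - (r - 1) = n.+1%:Z - r by rewrite -addn1 PoszD; ring.
Qed.

Theorem theorem2p1 (p alpha l n : nat) (r : int) :
  prime p ->
  T p alpha l n r != 0 ->
  ((tau p (frac_pm1 p alpha r) (frac_pm1 p alpha (n%:Z - r)))%:Z
     <= ordp p (T p alpha l n r))%R.
Proof.
move=> p_pr nz_T; apply: pdvd_ordp => //; case: alpha nz_T => [|a] _; last exact: pdvd_T.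
have -> : tau p (frac_pm1 p 0 r) (frac_pm1 p 0 (n%:Z - r)) = 0%N.
  by have := tau_logn p 0 0 p_pr; rewrite !logn1 !addn0.
rewrite T_Dcoef -pairingZ; exact: Dmult_int (Dmult_expr1subX0 p n p_pr) l r.
Qed.
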